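(* For all real $s\ge3$, $$s\,\omega(s)=1+\log(s-1)+\sum_{L=3}^{[s]}\int_{L-1}^{s-1}\int_{L-2}^{u_{L-1}-1}\cdots\int_1^{u_2-1}\prod_{j=1}^{L-1}\frac{du_j}{u_j}.$$
   Context: The Buchstab function $\omega$, defined on $[1,\infty)$, is the unique continuous function satisfying $\omega(s)=\frac1s$ for $1\le s\le2$ and $(s\omega(s))'=\omega(s-1)$ for $s>2$. $[s]$ denotes the integer part of $s$. In the $L$-th term, the iterated integral is $(L-1)$-fold: the outermost variable $u_{L-1}$ ranges over $[L-1,s-1]$, and for $1\le j\le L-2$ the variable $u_j$ ranges over $[j,u_{j+1}-1]$. *)

(* Defs.v *)
From Stdlib Require Import Reals List.
From Coquelicot Require Import Coquelicot.

Open Scope R_scope.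

(* [omega] is total on R but constrained only on [1, +oo); continuity is
   relative to that domain, hence one-sided at 1.  These conditions determine
   [omega] uniquely on [1, +oo). *)
Definition is_buchstab (omega : R -> R) : Prop :=
  continuous_on (fun s => 1 <= s) omega /\
  (forall s, 1 <= s <= 2 -> omega s = 1 / s) /\
  (forall s, 2 < s -> is_derive (fun t => t * omega t) s (omega (s - 1))).

(* [iter_RInt k b F] is
     int_{k}^{b} int_{k-1}^{u_k - 1} ... int_{1}^{u_2 - 1}
       F [u_k; ...; u_1] du_1 ... du_k,
   with the outermost variable at the head of the list. *)
Fixpoint iter_RInt (k : nat) (b : R) (F : list R -> R) : R :=
  match k with
  | O => F nil
  | S k' =>
      RInt (fun u => iter_RInt k' (u - 1) (fun us => F (u :: us))) (INR k) b
  end.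

Definition prod_inv (us : list R) : R :=
  fold_right (fun u p => / u * p) 1 us.

(* Main.v *)
Require Import Defs.
From Stdlib Require Import Reals ZArith List Lra Lia.
From Coquelicot Require Import Coquelicot.

Open Scope R_scope.

(** Write [J k b] for the [k]-fold integral ([nested_int]), so that [J 0 = 1],
    [J 1 = ln], and [J (k + 1)] has derivative [J k (x - 1) / x] at [x].
    Summing these rules, the partial sums [T n x = J 0 x + ... + J n x] satisfy
    [T (n + 1)' x = T n (x - 1) / x] ([is_derive_sum_nested_int]).  Buchstab's
    equation says the same of [G s = s * omega s], namely
    [G' s = G (s - 1) / (s - 1)], after the shift [x = s - 1].

    Hence [G s = T n (s - 1)] for [n + 1 <= s <= n + 2], by induction on [n]
    ([buchstab_eq_sum_nested_int]).  For [n = 0] both sides are [1].  In the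
    step, both sides have the same derivative on the next interval, and they
    agree at its left endpoint because the new term [J (n + 1)] is an integral
    over a degenerate range there.  Taking [n + 1] to be the integer part of
    [s] and separating the terms [J 0] and [J 1] gives the formula.

    The integral is written in the statement with the whole product innermost;
    pulling the factors [/ u] out one by one ([iter_RInt_scal_prod_inv]) uses
    linearity of the integral, which requires the integrands to be integrable,
    hence the continuity results on [J]. *)

(** * The nested integrals in recursive form *)

(** This is [iter_RInt k b prod_inv] with each factor [/ u] moved out of the
    inner integrals, which makes it a single-variable recursion that can be
    differentiated in [b]. *)
Fixpoint nested_int (k : nat) (b : R) : R :=
  match k with
  | O => 1
  | S k' => RInt (fun u => / u * nested_int k' (u - 1)) (INR k) b
  end.

Lemma nested_int_diag (k : nat) : nested_int (S k) (INR (S k)) = 0.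
Proof. exact (RInt_point _ _). Qed.

Lemma continuous_nested_integrand (k : nat) (u : R) :
  (forall x, INR k - 1 < x -> continuous (nested_int k) x) ->
  INR k < u -> continuous (fun v => / v * nested_int k (v - 1)) u.
Proof.
intros Hk Hu.
assert (Hk0 := pos_INR k).
apply (continuous_mult (fun v => / v) (fun v => nested_int k (v - 1))).
- apply (continuous_Rinv u); lra.
- apply (continuous_comp (fun v => v - 1) (nested_int k)).
  + apply (ex_derive_continuous (fun v => v - 1)); auto_derive; exact I.
  + apply Hk; lra.
Qed.

Lemma ex_RInt_nested_integrand (k : nat) (b : R) :
  (forall x, INR k - 1 < x -> continuous (nested_int k) x) ->
  INR k < b ->
  ex_RInt (fun u => / u * nested_int k (u - 1)) (INR (S k)) b.
Proof.
intros Hk Hb.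
apply (ex_RInt_continuous (V := R_CompleteNormedModule)).
intros z Hz; apply continuous_nested_integrand; [exact Hk|].
rewrite S_INR in Hz.
assert (INR k < Rmin (INR k + 1) b) by (apply Rmin_glb_lt; lra).
lra.
Qed.

Lemma is_derive_nested_int_of_continuous (k : nat) (x : R) :
  (forall y, INR k - 1 < y -> continuous (nested_int k) y) ->
  INR k < x ->
  is_derive (nested_int (S k)) x (/ x * nested_int k (x - 1)).
Proof.
intros Hk Hx.
apply (is_derive_RInt (V := R_NormedModule)
         (fun u => / u * nested_int k (u - 1)) _ (INR (S k))).
- exists (mkposreal (x - INR k) ltac:(lra)); intros y Hy.
  apply (RInt_correct (V := R_CompleteNormedModule)).
  apply ex_RInt_nested_integrand; [exact Hk|].
  apply Rabs_def2 in Hy; unfold minus, plus, opp in Hy; simpl in Hy; lra.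
- apply continuous_nested_integrand; assumption.
Qed.

(** The lower limit of integration is [k], but continuity holds one unit
    further to the left: the integrand of [nested_int (k + 1)] at [u]
    needs [nested_int k] at [u - 1], so the margin to the left of the lower
    limit is preserved.  It makes the point [k] interior, which
    spares one-sided limits at the ends of the intervals used below. *)
Lemma continuous_nested_int (k : nat) (x : R) :
  INR k - 1 < x -> continuous (nested_int k) x.
Proof.
revert x; induction k as [|k IHk]; intros x Hx.
- apply continuous_const.
- rewrite S_INR in Hx.
  apply (ex_derive_continuous (nested_int (S k))).
  exists (/ x * nested_int k (x - 1)).
  apply is_derive_nested_int_of_continuous; [exact IHk | lra].
Qed.

Lemma is_derive_nested_int (k : nat) (x : R) :
  INR k < x ->
  is_derive (nested_int (S k)) x (/ x * nested_int k (x - 1)).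
Proof.
apply is_derive_nested_int_of_continuous, continuous_nested_int.
Qed.

Lemma nested_int_1 (x : R) : 0 < x -> nested_int 1 x = ln x.
Proof.
intros Hx.
assert (Hpos : 0 < Rmin 1 x) by (apply Rmin_glb_lt; lra).
simpl.
rewrite (RInt_ext _ (fun u => / u)) by (intros; apply Rmult_1_r).
apply is_RInt_unique.
replace (ln x) with (minus (ln x) (ln 1)).
2:{ rewrite ln_1; unfold minus, plus, opp; simpl; ring. }
apply (is_RInt_derive (V := R_CompleteNormedModule) ln (fun u => / u));
  intros u Hu.
- apply is_derive_ln; lra.
- apply continuous_Rinv; lra.
Qed.

Lemma iter_RInt_ext (k : nat) (b : R) (F G : list R -> R) :
  (forall us, F us = G us) -> iter_RInt k b F = iter_RInt k b G.
Proof.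
revert b F G; induction k as [|k IHk]; intros b F G HFG; simpl.
- apply HFG.
- apply RInt_ext; intros u _; apply IHk; intros us; apply HFG.
Qed.

(** The scalar [c] collects the factors [/ u] of the outer variables; with
    [c] fixed to [1] the induction would not go through. *)
Lemma iter_RInt_scal_prod_inv (k : nat) (b c : R) :
  INR k - 1 < b ->
  iter_RInt k b (fun us => c * prod_inv us) = c * nested_int k b.
Proof.
revert b c; induction k as [|k IHk]; intros b c Hb.
- reflexivity.
- rewrite S_INR in Hb.
  transitivity
    (RInt (fun u => scal c (/ u * nested_int k (u - 1))) (INR (S k)) b).
  + apply RInt_ext; intros u Hu.
    rewrite S_INR in Hu.
    assert (INR k < Rmin (INR k + 1) b) by (apply Rmin_glb_lt; lra).
    rewrite (iter_RInt_ext _ _ _ (fun us => (c * / u) * prod_inv us)).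
    * rewrite IHk by lra; unfold scal; simpl; unfold mult; simpl; ring.
    * intros us; simpl; ring.
  + apply (RInt_scal (V := R_CompleteNormedModule)).
    apply ex_RInt_nested_integrand; [apply continuous_nested_int | lra].
Qed.

Lemma iter_RInt_prod_inv (k : nat) (b : R) :
  INR k - 1 < b -> iter_RInt k b prod_inv = nested_int k b.
Proof.
intros Hb.
rewrite (iter_RInt_ext _ _ _ (fun us => 1 * prod_inv us)) by (intros; ring).
rewrite iter_RInt_scal_prod_inv by exact Hb; ring.
Qed.

(** * Comparison with the Buchstab function *)

Lemma is_derive_sum_nested_int (n : nat) (x : R) :
  INR n < x ->
  is_derive (fun y => sum_n (fun k => nested_int k y) (S n)) x
    (/ x * sum_n (fun k => nested_int k (x - 1)) n).
Proof.
induction n as [|n IHn]; intros Hx.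
- apply (is_derive_ext (fun y => 1 + nested_int 1 y)).
  { intros y; rewrite sum_Sn, sum_O; reflexivity. }
  rewrite sum_O.
  replace (/ x * _) with (plus 0 (/ x * nested_int 0 (x - 1)))
    by (unfold plus; simpl; ring).
  apply (is_derive_plus (fun _ => 1) (nested_int 1)).
  + apply (is_derive_const (K := R_AbsRing) (V := R_NormedModule)).
  + apply is_derive_nested_int, Hx.
- apply (is_derive_ext (fun y =>
      sum_n (fun k => nested_int k y) (S n) + nested_int (S (S n)) y)).
  { intros y; rewrite (sum_Sn _ (S n)); reflexivity. }
  rewrite sum_Sn.
  replace (/ x * _) with
    (plus (/ x * sum_n (fun k => nested_int k (x - 1)) n)
       (/ x * nested_int (S n) (x - 1)))
    by (symmetry; apply Rmult_plus_distr_l).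
  apply (is_derive_plus (fun y => sum_n (fun k => nested_int k y) (S n))
           (nested_int (S (S n)))).
  + apply IHn; rewrite S_INR in Hx; lra.
  + apply is_derive_nested_int, Hx.
Qed.

Lemma continuous_buchstab (omega : R -> R) (s : R) :
  is_buchstab omega -> 1 < s -> continuous omega s.
Proof.
intros [Hcont _] Hs.
apply (continuous_continuous_on (fun t => 1 <= t)); [|exact Hcont].
exists (mkposreal (s - 1) ltac:(lra)); intros y Hy.
apply Rabs_def2 in Hy; unfold minus, plus, opp in Hy; simpl in Hy; lra.
Qed.

Lemma buchstab_eq_sum_nested_int (omega : R -> R) (n : nat) (s : R) :
  is_buchstab omega -> INR n + 1 <= s <= INR n + 2 ->
  s * omega s = sum_n (fun k => nested_int k (s - 1)) n.
Proof.
intros Homega; revert s; induction n as [|n IHn]; intros s Hs.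
- rewrite sum_O; simpl in *.
  destruct Homega as [_ [H12 _]].
  rewrite H12 by lra; field; lra.
- rewrite S_INR in Hs.
  assert (Hn := pos_INR n).
  set (T := fun t => sum_n (fun k => nested_int k (t - 1)) (S n)).
  set (D := fun t => t * omega t - T t).
  assert (HT : forall t, INR n + 2 <= t ->
     is_derive T t (/ (t - 1) * sum_n (fun k => nested_int k (t - 1 - 1)) n)).
  { intros t Ht.
    replace (/ (t - 1) * _) with
      (1 * (/ (t - 1) * sum_n (fun k => nested_int k (t - 1 - 1)) n)) by ring.
    apply (is_derive_comp (K := R_AbsRing) (V := R_NormedModule)
      (fun x => sum_n (fun k => nested_int k x) (S n)) (fun t => t - 1)).
    - apply is_derive_sum_nested_int; lra.
    - auto_derive; [exact I | ring]. }
  assert (HD : D (INR n + 2) = 0).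
  { unfold D, T; rewrite (IHn (INR n + 2)) by lra.
    rewrite sum_Sn.
    replace (nested_int (S n) (INR n + 2 - 1)) with 0.
    2:{ rewrite <- (nested_int_diag n), S_INR; f_equal; ring. }
    unfold plus; simpl; ring. }
  destruct (MVT_gen D (INR n + 2) s (fun _ => 0)) as [c [_ Hc]].
  + intros t; rewrite Rmin_left, Rmax_right by lra; intros Ht.
    (* By the induction hypothesis at [t - 1], both derivatives equal
       [omega (t - 1)]. *)
    replace 0 with (omega (t - 1) -
      / (t - 1) * sum_n (fun k => nested_int k (t - 1 - 1)) n).
    2:{ rewrite <- IHn by lra; field; lra. }
    apply (is_derive_minus (fun t => t * omega t) T).
    * apply Homega; lra.
    * apply HT; lra.
  + intros t; rewrite Rmin_left, Rmax_right by lra; intros Ht.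
    apply continuity_pt_filterlim.
    apply (continuous_minus (fun t => t * omega t) T).
    * apply (continuous_mult (fun t => t) omega).
      -- apply continuous_id.
      -- apply continuous_buchstab; [exact Homega | lra].
    * apply (ex_derive_continuous T); eexists; apply HT; lra.
  + rewrite HD in Hc.
    change (s * omega s = T s); unfold D in Hc; lra.
Qed.

Theorem proposition4 (omega : R -> R) (Homega : is_buchstab omega)
    (s : R) (hs : 3 <= s) :
  s * omega s =
    1 + ln (s - 1) +
    sum_n_m (fun L : nat => iter_RInt (L - 1) (s - 1) prod_inv)
      3 (Z.to_nat (Int_part s)).
Proof.
destruct (base_Int_part s) as [Hle Hgt].
assert (HZ : (3 <= Int_part s)%Z).
{ assert (2 < Int_part s)%Z by (apply lt_IZR; lra); lia. }
destruct (Z.to_nat (Int_part s)) as [|[|[|m]]] eqn:Em; [lia..|].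
assert (Hm : INR m + 3 = IZR (Int_part s)).
{ rewrite <- (Z2Nat.id (Int_part s)), Em by lia.
  rewrite <- INR_IZR_INZ, !S_INR; ring. }
rewrite (buchstab_eq_sum_nested_int omega (S (S m))) by
  (exact Homega || (rewrite !S_INR; lra)).
unfold sum_n; rewrite 2!(sum_Sn_m (fun k => nested_int k _)) by lia.
rewrite nested_int_1 by lra.
rewrite <- (sum_n_m_S (fun L => iter_RInt (L - 1) (s - 1) prod_inv)).
rewrite (sum_n_m_ext_loc
  (fun n => iter_RInt (S n - 1) (s - 1) prod_inv)
  (fun k => nested_int k (s - 1))).
- symmetry; apply Rplus_assoc.
- intros k Hk.
  replace (S k - 1)%nat with k by lia.
  apply iter_RInt_prod_inv.
  assert (HkR : INR k <= INR (S (S m))) by (apply le_INR; lia).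
  rewrite !S_INR in HkR; lra.
Qed.
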